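(* Let $G$ be a finite group such that $(G,Z(G))$ is a Camina pair and $(G/Z(G),Z(G/Z(G)))$ is a generalized Camina pair. Then $$\zeta^{w_3}_G=|G|^2\sum_{\chi\in\mathrm{lin}(G)}\chi+\left(\frac{|G|^3}{|G'|}+\frac{|G|^2|Z_2(G)|(|G'|-|Z(G)|)}{|G'||Z(G)|}\right)\sum_{\chi\in\mathrm{Irr}(G|Z(G))}\frac{\chi}{\chi(1)}+\frac{|G|^3}{|Z_2(G)|}\sum_{\chi\in\mathrm{nl}(G/Z(G))}\frac{\chi}{\chi(1)}.$$
   Context: $[a,b]=a^{-1}b^{-1}ab$, $w_3(x_1,x_2,x_3)=[[x_1,x_2],x_3]$, and $\zeta^{w_3}_G(g)=|\{(a_1,a_2,a_3)\in G^3: w_3(a_1,a_2,a_3)=g\}|$. $Z(G)$ is the center, $Z_2(G)$ is the second center ($Z_2(G)/Z(G)=Z(G/Z(G))$), $G'=[G,G]$. A pair $(G,H)$ is a Camina pair if $1<H<G$ is a normal subgroup of $G$ and $gH\subseteq \mathrm{Cl}_G(g)$ (the conjugacy class of $g$) for every $g\in G\setminus H$. For $N$ normal in a group $K$, $(K,N)$ is a generalized Camina pair if $\chi(g)=0$ for every nonlinear irreducible complex character $\chi$ of $K$ and every $g\in K\setminus N$. $\mathrm{Irr}(G)$, $\mathrm{lin}(G)$, $\mathrm{nl}(G)$ are the sets of all irreducible, linear, and nonlinear irreducible complex characters of $G$. For $N$ normal in $G$, characters of $G/N$ are identified with their inflations to $G$, and $\mathrm{Irr}(G|N)=\mathrm{Irr}(G)\setminus\mathrm{Irr}(G/N)$.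 *)

(* Defs.v *)
From mathcomp Require Import all_boot all_order all_algebra.
From mathcomp Require Import all_fingroup all_solvable all_field all_character.

Set Implicit Arguments.
Unset Strict Implicit.
Unset Printing Implicit Defensive.

Import GroupScope GRing.Theory Num.Theory.

(* MathComp's commutator is [~ x, y] = x^-1 * y^-1 * x * y. *)
Definition w3 (gT : finGroupType) (x1 x2 x3 : gT) : gT := [~ [~ x1, x2], x3].

Definition zeta_w3 (gT : finGroupType) (G : {group gT}) (g : gT) : nat :=
  #|[set a : gT * gT * gT | [&& a.1.1 \in G, a.1.2 \in G, a.2 \in G
                              & w3 a.1.1 a.1.2 a.2 == g]]|.

Definition camina_pair (gT : finGroupType) (G H : {group gT}) : Prop :=
  [/\ H :!=: 1, H \proper G, H <| G
    & forall g : gT, g \in G :\: H -> g *: H \subset g ^: G].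

(* N is allowed to be trivial or equal to K. *)
Definition gen_camina_pair (gT : finGroupType) (K N : {group gT}) : Prop :=
  N <| K /\
  forall (i : Iirr K) (g : gT),
    ('chi_i \isn't a linear_char)%R -> g \in K :\: N -> ('chi_i g = 0)%R.

(* Indices of Irr(G | N) = Irr(G) \ Irr(G / N), for N <| G; mod_Iirr is
   inflation from G / N to G, at the level of indices. *)
Definition Irr_over (gT : finGroupType) (G N : {group gT}) : {set Iirr G} :=
  ~: [set mod_Iirr j | j : Iirr (G / N)].

(* Main.v *)
Require Import Defs.
From mathcomp Require Import all_boot all_order all_algebra.
From mathcomp Require Import all_fingroup all_solvable all_field all_character.
From mathcomp Require Import ring.

(* Write Z, Z_2 for the first two centers of G. Second orthogonality in G / Z
   shows that a noncentral element of G / Z has a centralizer of order |G : G'|,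
   and this forces G' <= Z_2. For y = [a, b] in G', the map c |-> [y, c] is
   therefore trivial if y is in Z and otherwise, by the Camina property,
   |G : Z|-to-one onto Z. So zeta is determined by the number of pairs (a, b)
   with [a, b] in Z, which is read off the centralizers in G / Z. On the
   character side, every character of Irr(G | Z) has degree squared |G : Z| and
   every one of nl(G / Z) has degree squared |G : Z_2|, so that chi / chi(1) is a
   multiple of chi(1) chi and all the sums are differences of regular characters
   of quotients of G. *)

Set Implicit Arguments.
Unset Strict Implicit.
Unset Printing Implicit Defensive.

Import GroupScope GRing.Theory Num.Theory.
Local Open Scope ring_scope.

(** * Character sums over quotients, and degrees of characters vanishing off the center *)

Section Characters.

Variables (gT : finGroupType) (G : {group gT}).

(** These characters are the inflations from [G / N], so the sum is the regular character of [G / N]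
    at the coset of [g]. *)
Lemma sum_irr1_cfker (N : {group gT}) g : N <| G -> g \in G ->
  \sum_(i | N \subset cfker 'chi[G]_i) 'chi_i 1%g * 'chi_i g
    = #|G : N|%:R *+ (g \in N).
Proof.
move=> nsNG Gg; rewrite (reindex _ (mod_Iirr_bij nsNG)) /=.
have := cfRegE (G / N) (coset N g).
rewrite cfReg_sum sum_cfunE card_quotient ?normal_norm //.
rewrite -(sameP (kerP (coset_morphism N) (subsetP (normal_norm nsNG) g Gg)) eqP).
rewrite ker_coset => <-.
apply: eq_big => [i | i _]; first by rewrite mod_IirrE ?cfker_mod.
by rewrite !mod_IirrE ?cfMod1 ?cfModE // !cfunE.
Qed.

Lemma sum_lin_char g : g \in G ->
  \sum_(i | 'chi[G]_i \is a linear_char) 'chi_i g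
    = #|G : G^`(1)|%:R *+ (g \in G^`(1)%g).
Proof.
move=> Gg; rewrite -(sum_irr1_cfker (der_normal 1 G) Gg).
apply: eq_big => [i | i /lin_char1->]; last by rewrite mul1r.
exact: lin_irr_der1.
Qed.

(** A central [z] acts as a scalar in a representation affording the character. *)
Lemma irr_mul_center i z g : z \in 'Z(G) -> g \in G ->
  'chi[G]_i (g * z)%g * 'chi_i 1%g = 'chi_i g * 'chi_i z.
Proof.
move=> Zz Gg; have Gz := subsetP (center_sub G) z Zz.
have : z \in 'Z('chi_i)%CF by move: Zz; rewrite -cap_cfcenter_irr => /bigcapP->.
rewrite -irrRepr; move: 'Chi_i => rG.
rewrite cfcenter_repr inE => /andP[_ /is_scalar_mxP[a Da]].
rewrite !cfunE groupM // group1 Gz Gg repr_mxM // Da repr_mx1 mul_mx_scalar.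
by rewrite mxtraceZ !mxtrace_scalar mulrnAr; ring.
Qed.

(** This is the equality case of the bound chi(1)^2 <= |G : Z(chi)|. Here Z(chi) is just Z(G), since
    |chi| = chi(1) is nonzero on it. *)
Lemma irr1_sqr_vanish_center i :
    {in G :\: 'Z(G), forall g, 'chi[G]_i g = 0} ->
  'chi_i 1%g ^+ 2 = #|G : 'Z(G)|%:R.
Proof.
move=> chi0; have DZ: 'Z('chi_i)%CF = 'Z(G).
  rewrite -cap_cfcenter_irr; apply/eqP; rewrite eqEsubset (bigcap_inf i) // andbT cap_cfcenter_irr.
  apply/subsetP=> x Zx; have Gx := subsetP (cfcenter_sub _) x Zx.
  apply: contraLR Zx => notZx; rewrite irr_cfcenterE // chi0 1?in_setD ?notZx //.
  by rewrite normr0 eq_sym irr1_neq0.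
have [_ ] := irr1_bound i; rewrite DZ => /eqP.
have -> : 'chi_i \in 'CF(G, 'Z(G)).
  apply/cfun_onP=> x notZx; have [Gx | /cfun0-> //] := boolP (x \in G).
  by rewrite chi0 // in_setD notZx.
by move/eqP/eqP.
Qed.

Lemma mem_Irr_over (N : {group gT}) i : N <| G ->
  (i \in Irr_over G N) = ~~ (N \subset cfker 'chi_i).
Proof.
move=> nsNG; rewrite inE; congr (~~ _); apply/imsetP/idP=> [[j _ ->] | kerN].
  by rewrite mod_IirrE // cfker_mod.
by exists (quo_Iirr N i); rewrite ?quo_IirrK.
Qed.

End Characters.

(** * Generalized Camina pairs over the center *)

Section GenCamina.

Variables (gT : finGroupType) (K : {group gT}).
Hypothesis hK : gen_camina_pair K 'Z(K)%G.

(** In the second orthogonality relation at [x] only the |K : K'| linear characters survive, each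
    contributing 1. *)
Lemma gen_camina_card_cent1 x :
  x \in K :\: 'Z(K) -> #|'C_K[x]| = #|K : K^`(1)|.
Proof.
move=> notZx; have [Kx _] := setDP notZx.
have := second_orthogonality_relation x Kx; rewrite class_refl mulr1n => /esym.
rewrite (bigID (fun i => 'chi[K]_i \is a linear_char)) /= [X in _ + X]big1.
  rewrite addr0 (eq_bigr (fun=> 1)) => [|i lin_i].
    by rewrite sumr_const card_lin_irr => /eqP; rewrite eqr_nat => /eqP.
  by rewrite -normCK normC_lin_char ?expr1n.
by move=> i nl_i; rewrite (hK.2 i x) ?mul0r.
Qed.

(* A noncentral x in K' would have a class of size |K'| inside K', hence
   containing 1. *)
Lemma gen_camina_der1_sub : K^`(1)%g \subset 'Z(K).
Proof.
apply/subsetP=> x K'x; have Kx := subsetP (der_sub 1 K) x K'x.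
apply: contraT => notZx; have KZx: x \in K :\: 'Z(K) by rewrite in_setD notZx.
have sxK': x ^: K \subset K^`(1)%g by rewrite class_sub_norm ?K'x ?der_norm.
have Dclass: x ^: K = K^`(1)%g.
  (* Multiplied by |C_K(x)| = |K : K'|, the required |K'| <= |x^K| reads |K| <= |K|. *)
  apply/eqP; rewrite eqEcard sxK' -index_cent1 -(leq_pmul2r (cardG_gt0 'C_K[x])).
  rewrite mulnC [leqRHS]mulnC Lagrange ?subsetIl // gen_camina_card_cent1 //.
  by rewrite /= mulnC Lagrange ?der_sub.
have: 1%g \in x ^: K by rewrite Dclass group1.
case/imsetP=> y _ /eqP; rewrite eq_sym conjg_eq1 => /eqP x1.
by rewrite x1 group1 in notZx.
Qed.

Lemma gen_camina_irr1_sqr i : 'chi[K]_i \isn't a linear_char ->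
  'chi_i 1%g ^+ 2 = #|K : 'Z(K)|%:R.
Proof. by move=> nl_i; apply: irr1_sqr_vanish_center => x; apply: hK.2. Qed.

End GenCamina.

(** * Camina pairs over the center *)

Section CaminaCenter.

Variables (gT : finGroupType) (G : {group gT}).
Hypothesis hG : camina_pair G 'Z(G)%G.

Lemma camina_center_conj g z : g \in G :\: 'Z(G) -> z \in 'Z(G) ->
  (g * z)%g \in g ^: G.
Proof.
case: hG => _ _ _ cl notZg Zz.
by rewrite (subsetP (cl g notZg)) ?mem_lcoset ?mulKg.
Qed.

(** Take a central [z] outside the kernel: gz is conjugate to g, so chi(g) chi(1) = chi(g) chi(z),
    while chi(z) differs from chi(1). *)
Lemma camina_irr_over_vanish i g :
  i \in Irr_over G 'Z(G)%G -> g \in G :\: 'Z(G) -> 'chi_i g = 0.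
Proof.
rewrite mem_Irr_over ?center_normal // => /subsetPn[z Zz ker'z] notZg.
have [Gg _] := setDP notZg; have := irr_mul_center i Zz Gg.
have [y Gy ->] := imsetP (camina_center_conj notZg Zz).
rewrite cfunJ // => /eqP; rewrite -subr_eq0 -mulrBr mulf_eq0 subr_eq0.
by case/orP=> /eqP // Dz; rewrite cfkerEirr inE Dz eqxx in ker'z.
Qed.

(** For a noncentral [g], gz = g^y for some [y], whence z = [g, y]. *)
Lemma camina_center_sub_der1 : 'Z(G) \subset G^`(1)%g.
Proof.
case: hG => _ /properP[_ [g Gg notZg]] _ _; apply/subsetP=> z Zz.
have KZg: g \in G :\: 'Z(G) by rewrite in_setD notZg.
have [y Gy] := imsetP (camina_center_conj KZg Zz).
by rewrite conjg_mulR => /mulgI->; rewrite mem_commg.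
Qed.

(** The class of [y] is the full coset y Z(G), so the nonempty fibers of c |-> [y, c] are cosets of
    C_G(y), which has index |Z(G)|. *)
Lemma camina_card_commg_fiber y g : y \in 'Z_2(G) :\: 'Z(G) ->
  (#|[set c in G | [~ y, c]%g == g]| * #|'Z(G)| = #|G| * (g \in 'Z(G)))%N.
Proof.
case/setDP=> Z2y notZy; have Gy := subsetP (ucn_sub 2 G) y Z2y.
have Zcomm c : c \in G -> [~ y, c]%g \in 'Z(G).
  by move=> Gc; rewrite -ucn1 (subsetP (ucn_comm 1 G)) ?mem_commg.
have KZy: y \in G :\: 'Z(G) by rewrite in_setD notZy.
have [Zg | notZg] := boolP (g \in 'Z(G)); last first.
  rewrite muln0 (_ : [set _ in _ | _] = set0) ?cards0 //; apply/setP=> c.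
  rewrite inE in_set0; apply: contraNF notZg => /andP[Gc /eqP<-].
  exact: Zcomm.
have Dclass: y ^: G = (y *: 'Z(G))%g.
  apply/eqP; rewrite eqEsubset; apply/andP; split.
    apply/subsetP=> _ /imsetP[c Gc ->].
    by rewrite mem_lcoset conjg_mulR mulKg Zcomm.
  by apply/subsetP=> _ /lcosetP[z Zz ->]; apply: camina_center_conj.
have [c0 Gc0 Dyg] := imsetP (camina_center_conj KZy Zg).
(* An element [c] conjugates [y] to yg, as [c0] does, iff c c0^-1 centralizes [y]. *)
have ->: [set c in G | [~ y, c]%g == g] = ('C_G[y] :* c0)%g.
  apply/setP=> c; rewrite mem_rcoset inE in_setI groupMr ?groupV //.
  congr (_ && _); rewrite -(inj_eq (mulgI y)) -conjg_mulR Dyg.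
  rewrite -(inj_eq (conjg_inj c0^-1%g)) conjgK -conjgM.
  by rewrite cent1C; apply/eqP/cent1P => [/conjg_fixP/commgP | /commgP/conjg_fixP].
rewrite card_rcoset muln1 -(card_lcoset 'Z(G) y) -Dclass -index_cent1 Lagrange //.
exact: subsetIl.
Qed.

End CaminaCenter.

(** * Counting solutions of commutator equations *)

Lemma card_commg_center_fiber (gT : finGroupType) (G : {group gT}) y g :
  y \in 'Z(G) -> #|[set c in G | [~ y, c]%g == g]| = (#|G| * (g == 1%g))%N.
Proof.
case/centerP=> _ cGy.
have [-> | nt_g] := eqVneq; rewrite ?muln1 ?muln0.
  apply: eq_card => c; rewrite inE andb_idr // => Gc.
  by apply/commgP/cGy.
rewrite (_ : [set _ in _ | _] = set0) ?cards0 //; apply/setP=> c.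
rewrite inE in_set0; apply: contraNF nt_g => /andP[Gc /eqP<-].
exact/commgP/cGy.
Qed.

(** [a, b] lies in [N] iff the cosets of [a] and [b] commute, so the set is the preimage of a
    centralizer in [G / N]. *)
Lemma card_commg_in (gT : finGroupType) (G N : {group gT}) a :
  N <| G -> a \in G ->
  #|[set b in G | [~ a, b]%g \in N]| = (#|N| * #|'C_(G / N)[coset N a]|)%N.
Proof.
move=> nsNG Ga; have nNG := normal_norm nsNG; rewrite -card_cosetpre.
have Na := subsetP nNG a Ga; apply: eq_card => b; rewrite inE.
apply/andP/morphpreP => [[Gb Nab] | [Nb /setIP[Kb]]].
  have Nb := subsetP nNG b Gb; split=> //=; apply/setIP; split.
    exact: mem_quotient.
  by rewrite cent1C; apply/cent1P/commgP; rewrite -morphR //= coset_id.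
rewrite cent1C => /cent1P/commgP; rewrite -morphR //= => /eqP/coset_idr Nab.
by rewrite Nab ?groupR // -(quotientGK nsNG) mem_morphpre.
Qed.

Lemma zeta_w3_sum (gT : finGroupType) (G : {group gT}) g :
  zeta_w3 G g =
    (\sum_(a in G) \sum_(b in G) #|[set c in G | [~ [~ a, b], c]%g == g]|)%N.
Proof.
rewrite /zeta_w3 -sum1dep_card.
under [RHS]eq_bigr => a _ do under eq_bigr => b _ do rewrite -sum1dep_card.
rewrite pair_big pair_big_dep /=; apply: eq_bigl => -[[a b] c] /=.
by rewrite -!andbA.
Qed.

Lemma cosetpre_center (gT : finGroupType) (G : {group gT}) :
  coset 'Z(G) @*^-1 'Z(G / 'Z(G)) = 'Z_2(G).
Proof. by rewrite ucnSn ucn1. Qed.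

(** * Both hypotheses combined: the count and the character sums *)

Section DoubleCamina.

Variables (gT : finGroupType) (G : {group gT}).
Hypothesis hG : camina_pair G 'Z(G)%G.
Hypothesis hGZ : gen_camina_pair (G / 'Z(G))%G 'Z(G / 'Z(G))%G.

Let nsZG : 'Z(G) <| G := center_normal G.

Lemma der1_sub_ucn2 : G^`(1)%g \subset 'Z_2(G).
Proof.
rewrite -cosetpre_center -sub_quotient_pre; last first.
  exact: subset_trans (der_sub 1 G) (normal_norm nsZG).
by rewrite quotient_der ?normal_norm // gen_camina_der1_sub.
Qed.

Lemma index_der1_quotient_center :
  #|G / 'Z(G) : (G / 'Z(G))^`(1)%g| = #|G : G^`(1)%g|.
Proof.
rewrite -quotient_der ?normal_norm // index_quotient_eq ?der_sub ?normal_norm //.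
by rewrite (subset_trans (subsetIr _ _)) // camina_center_sub_der1.
Qed.

Lemma index_center_quotient_center :
  #|G / 'Z(G) : 'Z(G / 'Z(G))| = #|G : 'Z_2(G)|.
Proof.
rewrite -cosetpre_center -index_cosetpre; congr #|_ : _|; exact: quotientGK.
Qed.

Lemma card_commg_center a : a \in G ->
  #|[set b in G | [~ a, b]%g \in 'Z(G)]|
    = (if a \in 'Z_2(G) then #|G| else #|'Z(G)| * #|G : G^`(1)%g|)%N.
Proof.
move=> Ga; rewrite card_commg_in // -cosetpre_center.
have Na := subsetP (normal_norm nsZG) a Ga.
have Ka : coset 'Z(G) a \in (G / 'Z(G))%g by apply: mem_quotient.
case: ifPn => [/morphpreP[_ /setIP[_ cKa]] | notZ2a].
  rewrite (setIidPl _); last by rewrite sub_cent1.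
  by rewrite card_quotient ?normal_norm // Lagrange ?normal_sub.
rewrite (gen_camina_card_cent1 hGZ) ?index_der1_quotient_center //.
rewrite in_setD Ka andbT; apply: contra notZ2a => Za.
by rewrite mem_morphpre.
Qed.

Let n : algC := #|G|%:R.
Let d : algC := #|G^`(1)%g|%:R.
Let z : algC := #|'Z(G)%g|%:R.
Let z2 : algC := #|'Z_2(G)%g|%:R.

(** The terms split by whether [a] is in ['Z_2(G)], then by whether [a, b] is central; for [a]
    outside ['Z_2(G)] the latter holds for z n / d elements [b]. *)
Lemma zeta_w3E g : g \in G ->
  (zeta_w3 G g)%:R =
     z2 * n * (n *+ (g == 1%g))
     + (n - z2) * (z * n / d * (n *+ (g == 1%g))
                   + (n - z * n / d) * (n / z *+ (g \in 'Z(G)))).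
Proof.
(* [u] and [v] are the sizes of the fiber of c |-> [y, c] over [g], for [y] central and for [y] in
   ['Z_2(G)] but not central. *)
move=> Gg; set u := n *+ _; set v := n / z *+ _.
have fiber a b : a \in G -> b \in G ->
  #|[set c in G | [~ [~ a, b], c]%g == g]|%:R
     = if [~ a, b]%g \in 'Z(G) then u else v.
- move=> Ga Gb; case: ifPn => [Zab | notZab].
    by rewrite card_commg_center_fiber // natrM mulr_natr.
  have Z2ab: [~ a, b]%g \in 'Z_2(G) :\: 'Z(G).
    by rewrite in_setD notZab (subsetP der1_sub_ucn2) // mem_commg.
  have /(congr1 (fun k => k%:R : algC)) := camina_card_commg_fiber hG g Z2ab.
  rewrite !natrM => /(canRL (mulfK (neq0CG _)))->.
  by rewrite mulr_natr mulrnAl.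
have inner a : a \in G ->
  \sum_(b in G) #|[set c in G | [~ [~ a, b], c]%g == g]|%:R
    = if a \in 'Z_2(G) then n * u
      else z * n / d * u + (n - z * n / d) * v.
- move=> Ga; rewrite (eq_bigr _ (fun b => fiber a b Ga)).
  set A := [set b in G | [~ a, b]%g \in 'Z(G)].
  rewrite (big_setID A) /= (eq_bigr (fun=> u)); last first.
    by move=> b /setIP[_]; rewrite inE => /andP[_ ->].
  rewrite [X in _ + X](eq_bigr (fun=> v)); last first.
    by move=> b /setDP[Gb]; rewrite inE Gb /= => /negPf->.
  have sAG: A \subset G by apply/subsetP=> b; rewrite inE => /andP[].
  rewrite !sumr_const (setIidPr sAG) cardsDS // -(mulr_natl u) -(mulr_natl v).
  rewrite natrB ?subset_leq_card //.
  rewrite (card_commg_center Ga) -/n; case: ifP => _.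
    by rewrite -/n subrr mul0r addr0.
  by rewrite natrM natf_indexg ?der_sub // mulrA.
rewrite zeta_w3_sum natr_sum.
under eq_bigr => a Ga do rewrite natr_sum inner //.
rewrite (big_setID 'Z_2(G)) /= (setIidPr (ucn_sub 2 G)).
rewrite (eq_bigr (fun=> n * u)) => [|a ->//].
rewrite [X in _ + X](eq_bigr (fun=> z * n / d * u + (n - z * n / d) * v));
  last by move=> a /setDP[_ /negPf->].
rewrite !sumr_const cardsDS ?ucn_sub // -(mulr_natl (n * u)).
rewrite -(mulr_natl (_ + _)) natrB ?subset_leq_card ?ucn_sub //.
by rewrite mulrA.
Qed.

(** As chi(1)^2 = n / z, the sum is z / n times the regular character of [G] minus that of G /
    Z(G). *)
Lemma sum_irr_over_center g : g \in G ->
  \sum_(i in Irr_over G 'Z(G)%G) ('chi_i 1%g)^-1 * 'chi_i g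
    = z *+ (g == 1%g) - (g \in 'Z(G))%:R.
Proof.
move=> Gg.
have -> : \sum_(i in Irr_over G 'Z(G)%G) ('chi_i 1%g)^-1 * 'chi_i g
  = (n / z)^-1 * \sum_(i in Irr_over G 'Z(G)%G) 'chi_i 1%g * 'chi_i g.
- rewrite mulr_sumr; apply: eq_bigr => i Zi; rewrite mulrA; congr (_ * _).
  rewrite -natf_indexg ?center_sub // -(irr1_sqr_vanish_center (i := i)).
    by rewrite expr2 invfM mulfVK ?irr1_neq0.
  by move=> x; apply: camina_irr_over_vanish.
have := sum_irr1_cfker (normal1 G) Gg; rewrite indexg1 in_set1 -/n.
rewrite (eq_bigl predT) => [|i]; last by rewrite sub1G.
rewrite (bigID (mem (Irr_over G 'Z(G)%G))) /= => /(canRL (addrK _))->.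
rewrite [X in _ - X](eq_bigl (fun i : Iirr G => 'Z(G) \subset cfker 'chi_i)).
  rewrite sum_irr1_cfker // natf_indexg ?center_sub // -/n -/z.
  have n0 : n != 0 := neq0CG _; have z0 : z != 0 := neq0CG _.
  rewrite -2!(mulr_natr _ (nat_of_bool _)); field; exact/andP.
by move=> i; rewrite mem_Irr_over // negbK.
Qed.

(** As chi(1)^2 = n / z2, the sum is z2 / n times the regular character of G / Z(G) minus its linear
    part, which inflates to the regular character of G / G'. *)
Lemma sum_nonlinear_quotient_center g : g \in G ->
  \sum_(j | 'chi[G / 'Z(G)]_j \isn't a linear_char)
      ('chi_j 1%g)^-1 * 'chi_j (coset 'Z(G) g)
    = (n / z2)^-1 * (n / z *+ (g \in 'Z(G)) - n / d *+ (g \in G^`(1)%g)).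
Proof.
move=> Gg; have Kg : coset 'Z(G) g \in (G / 'Z(G))%g by apply: mem_quotient.
have Ng := subsetP (normal_norm nsZG) g Gg.
have -> : \sum_(j | 'chi[G / 'Z(G)]_j \isn't a linear_char)
      ('chi_j 1%g)^-1 * 'chi_j (coset 'Z(G) g) =
   (n / z2)^-1 * \sum_(j | 'chi[G / 'Z(G)]_j \isn't a linear_char)
      'chi_j 1%g * 'chi_j (coset 'Z(G) g).
- rewrite mulr_sumr; apply: eq_bigr => j nl_j; rewrite mulrA; congr (_ * _).
  rewrite -natf_indexg ?ucn_sub // -index_center_quotient_center.
  by rewrite -(gen_camina_irr1_sqr hGZ nl_j) expr2 invfM mulfVK ?irr1_neq0.
congr (_ * _).
have := sum_irr1_cfker (normal1 _) Kg.
rewrite (eq_bigl predT) => [|j]; last by rewrite sub1G.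
rewrite (bigID (fun j => 'chi[G / 'Z(G)]_j \is a linear_char)) /=.
move=> /(canRL (addKr _))->; rewrite addrC; congr (_ - _).
  rewrite indexg1 card_quotient ?normal_norm // natf_indexg ?center_sub //.
  congr (_ *+ nat_of_bool _); rewrite in_set1.
  by apply/eqP/idP => [/coset_idr-> // | /coset_id].
rewrite (eq_bigr (fun j => 'chi_j (coset 'Z(G) g))); last first.
  by move=> j /lin_char1->; rewrite mul1r.
rewrite sum_lin_char // index_der1_quotient_center natf_indexg ?der_sub //.
congr (_ *+ nat_of_bool _); rewrite -quotient_der ?normal_norm //.
(* Because Z(G) <= G', the preimage of G' / Z(G) is G' itself. *)
have nsZG' : 'Z(G) <| G^`(1)%g.
  by rewrite (normalS _ (der_sub 1 G)) ?camina_center_sub_der1.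
apply/idP/idP => [G'g | /mem_quotient->//].
by rewrite -(quotientGK nsZG') mem_morphpre.
Qed.

End DoubleCamina.

Theorem theorem3p14 (gT : finGroupType) (G : {group gT})
    (hG : camina_pair G 'Z(G)%G)
    (hGZ : gen_camina_pair (G / 'Z(G))%G 'Z(G / 'Z(G))%G) :
  forall g : gT, g \in G ->
    (zeta_w3 G g)%:R =
      (#|G|%:R ^+ 2 *: (\sum_(i : Iirr G | 'chi_i \is a linear_char) 'chi_i)
       + (#|G|%:R ^+ 3 / #|G^`(1)%g|%:R
          + #|G|%:R ^+ 2 * #|'Z_2(G)%g|%:R * (#|G^`(1)%g|%:R - #|'Z(G)%g|%:R)
            / (#|G^`(1)%g|%:R * #|'Z(G)%g|%:R))
         *: (\sum_(i in Irr_over G 'Z(G)%G) ('chi_i 1%g)^-1 *: 'chi_i)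
       + (#|G|%:R ^+ 3 / #|'Z_2(G)%g|%:R)
         *: (\sum_(j : Iirr (G / 'Z(G)) | 'chi_j \isn't a linear_char)
               ('chi_j 1%g)^-1 *: ('chi_j %% 'Z(G))%CF)) g.
Proof.
move=> g Gg; rewrite zeta_w3E // !cfunE !sum_cfunE.
rewrite sum_lin_char // natf_indexg ?der_sub //.
under [X in _ = _ + _ * X + _]eq_bigr => i _ do rewrite cfunE.
under [X in _ = _ + _ * X]eq_bigr => j _ do rewrite cfunE cfModE ?center_normal //.
rewrite sum_irr_over_center // sum_nonlinear_quotient_center //.
(* Indicators become factors, which [field] can treat as atoms. *)
have mulb (x : algC) (b : bool) : x *+ b = x * (if b then 1 else 0).
  by case: b; rewrite (mulr0, mulr1).
rewrite !mulb.
have n0 := neq0CG G; have d0 := neq0CG G^`(1)%G.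
have z0 := neq0CG 'Z(G)%G; have z20 := neq0CG 'Z_2(G)%G.
(* The indicator of G' cancels between the linear and the last sum; those of 1 and Z(G) have equal
   coefficients on both sides. *)
field; exact/and4P.
Qed.
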